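(* Let $n\ge 2$ be an integer, let $\mathcal{Q}_{4n}$ be the dicyclic group of order $4n$, and let $\lambda_1(\mathcal{P}(\mathcal{Q}_{4n}))$ denote the spectral radius of its power graph. Let $D_{avg}$ be the average degree of the power graph $\mathcal{P}(C_{2n})$ of the cyclic group $C_{2n}$ of order $2n$. Then $$\frac{1}{2}\left[(D_{avg}+1)+\sqrt{(D_{avg}-1)^{2}+16}\right] \le \lambda_{1}(\mathcal{P}(\mathcal{Q}_{4n}))\le 2n+1.$$
   Context: The power graph $\mathcal{P}(\mathbb{G})$ of a finite group $\mathbb{G}$ is the simple undirected graph with vertex set $\mathbb{G}$ in which two distinct elements $x,y$ are adjacent if and only if one of them is an integral power of the other. The dicyclic group is $\mathcal{Q}_{4n}=\langle a,b \mid a^{2n}=e,\ a^n=b^2,\ ab=ba^{-1}\rangle$, of order $4n$. The average degree of a graph is the arithmetic mean of its vertex degrees. The spectral radius $\lambda_1(G)$ of a graph $G$ is the largest eigenvalue of its adjacency matrix. *)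

(* Defs.v *)
From mathcomp Require Import all_boot all_order all_fingroup all_solvable.
From mathcomp Require Import all_algebra spectral.
From mathcomp Require Import mathcomp_extra boolp classical_sets reals.
From mathcomp Require Import complex polyrcf.

Set Implicit Arguments.
Unset Strict Implicit.
Unset Printing Implicit Defensive.

Import Order.TTheory GRing.Theory Num.Theory.
Local Open Scope ring_scope.

(* <[x]> is the set of integral powers of x: see [mem_cycle_intP]. *)
Definition power_graph (gT : finGroupType) : rel gT :=
  fun x y => (x != y) && ((y \in <[x]>%g) || (x \in <[y]>%g)).

Lemma mem_cycle_intP (gT : finGroupType) (x y : gT) :
  y \in <[x]>%g <-> exists k : nat, y = (x ^+ k)%g \/ y = (x ^- k)%g.
Proof.
split=> [/cycleP[k ->]|[k [->|->]]]; first by exists k; left.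
- exact: mem_cycle.
- by rewrite groupV mem_cycle.
Qed.

Lemma power_graph_sym (gT : finGroupType) : symmetric (@power_graph gT).
Proof. by move=> x y; rewrite /power_graph eq_sym orbC. Qed.

Lemma power_graph_irr (gT : finGroupType) : irreflexive (@power_graph gT).
Proof. by move=> x; rewrite /power_graph eqxx. Qed.

Definition vertex_degree (T : finType) (e : rel T) (x : T) : nat :=
  #|[set y | e x y]|.

Definition average_degree (R : realType) (T : finType) (e : rel T) : R :=
  (\sum_(x : T) vertex_degree e x)%:R / #|T|%:R.

Definition adjacency_mx (R : realType) (T : finType) (e : rel T) : 'M[R]_#|T| :=
  \matrix_(i, j) (e (enum_val i) (enum_val j))%:R.

Definition is_largest_eigenvalue (R : realType) (m : nat) (A : 'M[R]_m) (l : R) :=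
  eigenvalue A l /\ forall mu : R, eigenvalue A mu -> mu <= l.

(* The default 0 is irrelevant for nonempty simple graphs: see
   [spectral_radiusP]. *)
Definition spectral_radius (R : realType) (T : finType) (e : rel T) : R :=
  xget 0 [set l : R | is_largest_eigenvalue (adjacency_mx R e) l]%classic.

Lemma sym_eigenvalue_exists (R : rcfType) (m : nat) (A : 'M[R]_m) :
  (0 < m)%N -> A^T = A -> exists l : R, eigenvalue A l.
Proof.
move=> m0 As; pose B := map_mx (real_complex R) A.
have [a /eigenvalueP[v vB v0]] := eigenvalue_closed B m0.
have BH : map_mx Num.conj B^T = B.
  apply/matrixP=> i j; rewrite !mxE -{2}As mxE; exact: conjc_real.
have vB' : B *m (map_mx Num.conj v^T) = a^* *: (map_mx Num.conj v^T).
  by rewrite -[in LHS]BH -map_mxM -trmx_mul vB linearZ /= map_mxZ.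
have /eqP : a *: (v *m (map_mx Num.conj v^T)) = a^* *: (v *m (map_mx Num.conj v^T)).
  by rewrite scalemxAl -vB -mulmxA vB' scalemxAr.
rewrite -subr_eq0 -scalerBl scaler_eq0 => /orP[|/eqP vv0]; last first.
  by have := dotmx_is_dotmx v0; rewrite dotmxE vv0 mxE ltxx.
rewrite subr_eq0 => /eqP aR.
have /complex_realP[k ak] : a \is Num.real by apply/CrealP; rewrite -aR.
exists k; rewrite eigenvalue_root_char -(fmorph_root (real_complex R)).
rewrite map_char_poly -eigenvalue_root_char.
by apply/eigenvalueP; exists v => //; rewrite vB ak.
Qed.

Lemma sym_largest_eigenvalue (R : realType) (m : nat) (A : 'M[R]_m) :
  (0 < m)%N -> A^T = A -> exists l : R, is_largest_eigenvalue A l.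
Proof.
move=> m0 As; have [a aA] := sym_eigenvalue_exists m0 As.
have p0 : char_poly A != 0 by rewrite monic_neq0 ?char_poly_monic.
have rE x : (x \in rootsR (char_poly A)) = eigenvalue A x.
  by rewrite eigenvalue_root_char -(roots_on_rootsR p0).
pose s := rootsR (char_poly A).
exists (\big[Num.max/a]_(x <- s) x); split.
  rewrite -rE -/s big_seq; elim/big_ind: _ => //; first by rewrite rE.
  by move=> x y xs ys; case: leP.
by move=> mu; rewrite -rE => mus; apply: (@le_bigmax_seq _ _ _ _ _ mu xpredT id).
Qed.

Lemma spectral_radiusP (R : realType) (T : finType) (e : rel T) :
    (0 < #|T|)%N -> symmetric e ->
  is_largest_eigenvalue (adjacency_mx R e) (spectral_radius R e).
Proof.
move=> T0 es; have [|l lP] := sym_largest_eigenvalue T0 (A := adjacency_mx R e).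
  by apply/matrixP=> i j; rewrite !mxE es.
exact: (xgetPex 0 (ex_intro _ l lP)).
Qed.

Definition is_cyclic_group (gT : finGroupType) (m : nat) : Prop :=
  cyclic [set: gT]%g /\ #|gT| = m.

(* [\isog Grp] says that the group is isomorphic to the largest finite group
   with this presentation; the presented group being finite, of order 4n, this
   is the presented group itself. *)
Definition is_dicyclic_group (gT : finGroupType) (n : nat) : Prop :=
  [set: gT]%g \isog Grp
    (a : b : a ^+ (2 * n)%N, a ^+ n = b ^+ 2, a * b = b * a^-1)%g.

(* Main.v *)
Require Import Defs.
From mathcomp Require Import all_boot all_order all_fingroup all_solvable.
From mathcomp Require Import all_algebra reals.
From mathcomp Require Import sesquilinear spectral complex ring lra zify.

(** Let H be the cyclic subgroup <[a]> of the dicyclic group and z = a ^+ n.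
    Only the following about the group matters: H has order 2n and index 2, z is
    an involution of H, and every element outside H squares to z
    ([dicyclic_structure]).  An element y outside H therefore has order 4 and
    <[y]> = {1, y, z, y^-1}, so that in the power graph the neighbours of y are
    exactly 1, z and y^-1 ([power_graph_outer_half]), while inside H one sees
    the power graph of the cyclic group of order 2n ([isog_degree_sum]).

    Lower bound.  By the spectral theorem the largest eigenvalue dominates every
    Rayleigh quotient ([sym_rayleigh]).  On vectors equal to p on H and to q off
    H, both halves having 2n elements, the quotient is at least
    (D p^2 + 4 p q + q^2) / (p^2 + q^2) when p, q >= 0, where D is the average
    degree inside H.  This is the quadratic form of the matrix [[D, 2], [2, 1]],
    whose larger eigenvalue mu is the left-hand side of the claim, with
    eigenvector (mu - 1, 2).

    Upper bound.  If a nonnegative matrix A satisfies A w <= c w for a positive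
    vector w, all its eigenvalues are at most c ([nonneg_eigenvalue_le]).  For
    c = 2n + 1, the weight 2n on 1 and z, n on the rest of H and 2 off H will
    do.  It is enough to count every pair of distinct elements of H as adjacent,
    and to bound the neighbourhoods of 1 and z by the whole group.

    That the presented group does not collapse to order less than 4n is seen
    from its regular representation on Z/2n x {0,1} ([dicyclic_model]). *)

Set Implicit Arguments.
Unset Strict Implicit.
Unset Printing Implicit Defensive.

Import Order.TTheory GRing.Theory Num.Theory.
Local Open Scope ring_scope.

(** * Eigenvalues of symmetric and of nonnegative matrices *)

(** After extension of scalars to R[i], A becomes Hermitian and is diagonalised
    by a unitary matrix.  The diagonal entries are real, hence eigenvalues of A
    over R, hence at most l; in the orthonormal coordinates w of v the two sides
    are the sums of d_i |w_i|^2 and of l |w_i|^2. *)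
Lemma sym_rayleigh (R : rcfType) m (A : 'M[R]_m) (l : R) :
    A^T = A -> (forall mu, eigenvalue A mu -> mu <= l) ->
  forall v : 'rV[R]_m, (v *m A *m v^T) 0 0 <= l * (v *m v^T) 0 0.
Proof.
move=> As lmax v; pose c := real_complex R; pose B := map_mx c A.
have cconj k p (M : 'M[R]_(k, p)) : map_mx Num.conj (map_mx c M) = map_mx c M.
  by apply/matrixP=> i j; rewrite !mxE; exact: conjc_real.
have Bherm : B \is hermsymmx.
  by apply/is_hermitianmxP; rewrite expr0 scale1r /B map_trmx As cconj.
pose P := spectralmx B; pose d := spectral_diag B.
have Pu : P \is unitarymx := spectral_unitarymx B.
have BE : B = invmx P *m diag_mx d *m P.
  exact/orthomx_spectralP/hermitian_normalmx.
have PB : P *m B = diag_mx d *m P.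
  by rewrite BE !mulmxA mulmxV ?mul1mx ?spectral_unit.
have d_le i : d 0 i <= c l.
  have /mxOverP/(_ 0 i)/complex_realP[k dk] := hermitian_spectral_diag_real Bherm.
  rewrite -/d in dk; rewrite dk lecR; apply: lmax.
  rewrite eigenvalue_root_char -(fmorph_root c) map_char_poly -eigenvalue_root_char.
  apply/eigenvalueP; exists (row i P).
    by rewrite -row_mul PB row_mul row_diag_mx -scalemxAl -rowE dk.
  (* A row of a unitary matrix has norm 1, so it cannot vanish. *)
  apply/negP => /eqP Pi0; have /unitarymxP/(congr1 (row i)) := Pu.
  rewrite row_mul Pi0 mul0mx => /matrixP/(_ 0 i)/eqP.
  by rewrite !mxE eqxx eq_sym oner_eq0.
pose u := map_mx c v; pose w := u *m map_mx Num.conj P^T.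
have wT : map_mx Num.conj w^T = P *m u^T.
  rewrite /w trmx_mul map_mxM.
  by rewrite -map_trmx trmxK -map_mx_comp (map_mx_id (@conjCK _)) /u map_trmx cconj.
have uB : u *m B *m u^T = w *m diag_mx d *m map_mx Num.conj w^T.
  by rewrite wT BE invmx_unitary // /w !mulmxA.
have uu : u *m u^T = w *m map_mx Num.conj w^T.
  by rewrite wT /w -(invmx_unitary Pu) mulmxA mulmxKV ?unitarymx_unit.
suff: c ((v *m A *m v^T) 0 0) <= c l * c ((v *m v^T) 0 0) by rewrite -rmorphM lecR.
have -> : c ((v *m A *m v^T) 0 0) = (u *m B *m u^T) 0 0.
  by rewrite /u /B map_trmx -!map_mxM [RHS]mxE.
have -> : c ((v *m v^T) 0 0) = (u *m u^T) 0 0.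
  by rewrite /u map_trmx -!map_mxM [RHS]mxE.
rewrite uB uu mul_mx_diag !mxE mulr_sumr; apply: ler_sum => i _.
rewrite !mxE mulrAC mulrC; apply: ler_wpM2r => //; exact: mul_conjC_ge0.
Qed.

(** If v is an eigenvector for l, then l |v| <= |v| A entrywise; pairing this with
    w gives l <|v|, w> <= <|v|, A w> <= c <|v|, w>, where <|v|, w> > 0. *)
Lemma nonneg_eigenvalue_le (R : realFieldType) m (A : 'M[R]_m) (w : 'cV[R]_m)
    (c l : R) :
    (forall i j, 0 <= A i j) -> (forall i, 0 < w i 0) ->
    (forall i, (A *m w) i 0 <= c * w i 0) ->
  eigenvalue A l -> l <= c.
Proof.
move=> A0 w0 Aw /eigenvalueP[v vA v0].
have [i vi0] : exists i, v 0 i != 0 by apply/rV0Pn.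
have S0 : 0 < \sum_j `|v 0 j| * w j 0.
  rewrite (bigD1 i) //= ltr_pwDl //; first by rewrite mulr_gt0 ?normr_gt0.
  by apply: sumr_ge0 => j _; rewrite mulr_ge0 // ltW.
rewrite -(ler_pM2r S0) mulr_sumr.
apply: (@le_trans _ _ (\sum_j (\sum_k `|v 0 k| * A k j) * w j 0)).
  apply: ler_sum => j _; rewrite mulrA ler_wpM2r ?(ltW (w0 j)) //.
  apply: (@le_trans _ _ `|(l *: v) 0 j|).
    by rewrite mxE normrM ler_wpM2r // ler_norm.
  rewrite -vA mxE; apply: le_trans (ler_norm_sum _ _ _) _.
  by apply: ler_sum => k _; rewrite normrM (ger0_norm (A0 k j)).
under eq_bigr do rewrite mulr_suml.
rewrite exchange_big mulr_sumr /=; apply: ler_sum => k _.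
have := Aw k; rewrite mxE => /(ler_wpM2l (normr_ge0 (v 0 k))).
rewrite mulr_sumr mulrCA; apply: le_trans.
by under eq_bigr do rewrite -mulrA.
Qed.

(** * Bounds on the spectral radius of a graph *)

Lemma spectral_radius_ge (R : realType) (T : finType) (e : rel T) (w : T -> R) :
    (0 < #|T|)%N -> symmetric e ->
  \sum_x \sum_(y | e x y) w x * w y <= spectral_radius R e * \sum_x w x ^+ 2.
Proof.
move=> T0 es; have [_ lmax] := spectral_radiusP R T0 es.
have As : (adjacency_mx R e)^T = adjacency_mx R e.
  by apply/matrixP => i j; rewrite !mxE es.
have := sym_rayleigh As lmax (\row_i w (enum_val i)).
rewrite -mulmxA !mxE !(reindex _ (onW_bij _ (@enum_val_bij T))) /=.
congr (_ <= _ * _); apply: eq_bigr => i _; rewrite !mxE // mulr_sumr.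
rewrite (reindex _ (onW_bij _ (@enum_val_bij T))) /= [RHS]big_mkcond /=.
by apply: eq_bigr => j _; rewrite !mxE; case: ifP; rewrite ?mul1r ?mul0r ?mulr0.
Qed.

Lemma spectral_radius_le (R : realType) (T : finType) (e : rel T) (w : T -> R)
    (c : R) :
    (0 < #|T|)%N -> symmetric e -> (forall x, 0 < w x) ->
    (forall x, \sum_(y | e x y) w y <= c * w x) ->
  spectral_radius R e <= c.
Proof.
move=> T0 es w0 ew; have [lA _] := spectral_radiusP R T0 es.
apply: (nonneg_eigenvalue_le (w := \col_i w (enum_val i)) _ _ _ lA) => [i j|i|i].
- by rewrite mxE ler0n.
- by rewrite mxE.
rewrite !mxE; apply: le_trans (ew _).
rewrite (reindex _ (onW_bij _ (@enum_val_bij T))) /= [leRHS]big_mkcond /=.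
apply: ler_sum => j _; rewrite !mxE.
by case: ifP; rewrite ?mul1r ?mul0r.
Qed.

(** Counts ordered pairs: an edge with both ends in [A :&: B] counts twice, so
    that [edges_between e A A] is the degree sum of the subgraph induced on A. *)
Definition edges_between (T : finType) (e : rel T) (A B : {set T}) : nat :=
  \sum_(x in A) #|[set y in B | e x y]|.

Lemma edges_betweenE (R : pzSemiRingType) (T : finType) (e : rel T)
    (A B : {set T}) :
  (edges_between e A B)%:R = \sum_(x in A) \sum_(y in B) (e x y)%:R :> R.
Proof.
rewrite natr_sum; apply: eq_bigr => x _.
by rewrite -natr_sum -sum1dep_card big_mkcondr; congr (_%:R).
Qed.

(** The Rayleigh quotient of the vector equal to p on S and to q off S. *)
Lemma spectral_radius_ge_blocks (R : realType) (T : finType) (e : rel T)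
    (S : {set T}) (p q : R) :
    (0 < #|T|)%N -> symmetric e ->
  p ^+ 2 * (edges_between e S S)%:R
    + 2 * p * q * (edges_between e (~: S) S)%:R
    + q ^+ 2 * (edges_between e (~: S) (~: S))%:R
  <= spectral_radius R e * (p ^+ 2 * #|S|%:R + q ^+ 2 * #|~: S|%:R).
Proof.
move=> T0 es; pose w x := if x \in S then p else q.
have split_sum (F : T -> R) :
    \sum_x F x = \sum_(x in S) F x + \sum_(x in ~: S) F x.
  rewrite (bigID (mem S)) /=; congr (_ + _).
  by apply: eq_bigl => x; rewrite inE.
have wS x : x \in S -> w x = p by rewrite /w => ->.
have wC x : x \in ~: S -> w x = q by rewrite inE /w => /negPf ->.
have cst (A B : {set T}) (s t : R) :
    (forall x, x \in A -> w x = s) -> (forall x, x \in B -> w x = t) ->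
    \sum_(x in A) \sum_(y in B) (e x y)%:R * (w x * w y)
      = s * t * (edges_between e A B)%:R.
  move=> wA wB; rewrite edges_betweenE mulr_sumr; apply: eq_bigr => x xA.
  rewrite mulr_sumr; apply: eq_bigr => y yB.
  by rewrite wA // wB // mulrC.
have := spectral_radius_ge w T0 es.
have -> : \sum_x w x ^+ 2 = p ^+ 2 * #|S|%:R + q ^+ 2 * #|~: S|%:R.
  rewrite split_sum; congr (_ + _); rewrite mulr_natr -sumr_const.
    by apply: eq_bigr => x /wS ->.
  by apply: eq_bigr => x /wC ->.
apply: le_trans; rewrite le_eqVlt; apply/orP; left; apply/eqP.
have -> : \sum_x \sum_(y | e x y) w x * w y
    = \sum_x \sum_y (e x y)%:R * (w x * w y).
  apply: eq_bigr => x _; rewrite big_mkcond; apply: eq_bigr => y _.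
  by case: (e x y); rewrite ?mul1r ?mul0r.
rewrite split_sum; under eq_bigr do rewrite split_sum.
under [X in _ = _ + X]eq_bigr do rewrite split_sum.
rewrite !big_split /= (cst _ _ p p) // (cst _ _ p q) // (cst _ _ q p) //.
rewrite (cst _ _ q q) //.
have -> : (edges_between e S (~: S))%:R = (edges_between e (~: S) S)%:R :> R.
  rewrite !edges_betweenE exchange_big; apply: eq_bigr => x _.
  by apply: eq_bigr => y _; rewrite es.
ring.
Qed.

(** * The dicyclic group *)

(** The group is realised by permutations of the set of normal forms a^i b^s,
    encoded as pairs (i, s): [f] and [g] are multiplication by a and by b on the
    left.  Permutations compose from left to right, so this realises the opposite
    group; it satisfies the same relations, the last of them being equivalent to
    a b a = b.  The orbit of (0, false) is the whole set, so the group has at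
    least 4n elements. *)
Lemma dicyclic_model (n : nat) : (0 < n)%N ->
  exists (rT : finGroupType) (G : {group rT}), (4 * n <= #|G|)%N /\
    G \homg Grp
      (a : b : a ^+ (2 * n)%N, a ^+ n = b ^+ 2, a * b = b * a^-1)%g.
Proof.
move=> n0; set m := (2 * n)%N.
have m1 : (1 < m)%N.
  by rewrite /m mul2n -addnn; case: n n0 {m} => // k _; rewrite addnS.
have mR : m%:R = 0 :> 'Z_m by rewrite pchar_Zp.
have nn : n%:R + n%:R = 0 :> 'Z_m by rewrite -natrD addnn -mul2n.
have nN : - n%:R = n%:R :> 'Z_m by apply/esym/eqP; rewrite -addr_eq0 nn.
have nBB i : - (n%:R - i) = i + n%:R :> 'Z_m by rewrite opprB nN.
have oppSK i : - (i + 1) + 1 = - i :> 'Z_m by rewrite opprD subrK.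
have nSK i : n%:R - (i + 1) + 1 = n%:R - i :> 'Z_m by rewrite -addrA oppSK.
pose f (p : 'Z_m * bool) : 'Z_m * bool := (p.1 + 1, p.2).
pose g (p : 'Z_m * bool) : 'Z_m * bool :=
  (if p.2 then n%:R - p.1 else - p.1, ~~ p.2).
have f_inj : injective f.
  by move=> [i s] [j t] /eqP/andP[/= /eqP/addIr -> /eqP ->].
have g_inj : injective g.
  move=> [i s] [j t] /eqP/andP[/= /eqP + /eqP/negb_inj e]; rewrite e.
  by case: t {e} => [/addrI|] /oppr_inj ->.
pose a := perm f_inj; pose b := perm g_inj.
have aX k p : (a ^+ k)%g p = (p.1 + k%:R, p.2).
  elim: k => [|k IH]; first by rewrite expg0 perm1 addr0; case: p.
  by rewrite expgSr permM IH permE /f /= -natr1 addrA.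
exists {perm 'Z_m * bool}, (<[a]> <*> <[b]>)%G; split; last first.
  apply/existsP; exists (a, b); rewrite /= !xpair_eqE eqxx /=; apply/and3P; split.
  - by apply/eqP/permP => p; rewrite aX mR addr0 perm1; case: p.
  - apply/eqP/permP => -[i s]; rewrite aX expgS expg1 permM !permE /g /=.
    by case: s; rewrite /= ?nBB // opprK addrC.
  - apply/eqP/(canRL (mulgK a))/permP => -[i s]; rewrite !permM !permE /f /g /=.
    by case: s; rewrite /= ?nSK ?oppSK.
have -> : (4 * n)%N = #|[set: 'Z_m * bool]|.
  by rewrite cardsT card_prod card_bool card_ord Zp_cast // muln2 /m -!mul2n mulnA.
apply: leq_trans (leq_imset_card (fun p : {perm 'Z_m * bool} => p (0, false)) _).
apply/subset_leq_card/subsetP => -[i s] _; apply/imsetP.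
exists ((if s then b else 1) * a ^+ i)%g; last first.
  by rewrite permM aX; case: s; rewrite ?perm1 ?permE /g /= ?oppr0 add0r natr_Zp.
rewrite groupM //; last by rewrite groupX // mem_gen // inE cycle_id.
by case: s => //; rewrite mem_gen // inE cycle_id orbT.
Qed.

(** What the power graph of the dicyclic group depends on, for H = <[a]> and
    z = a ^+ n. *)
Definition half_with_common_square (gT : finGroupType) (H : {group gT})
    (z : gT) (n : nat) : Prop :=
  [/\ #|H| = (2 * n)%N, #|gT| = (4 * n)%N, z \in H, #[z]%g = 2%N
    & forall y, y \notin H -> (y ^+ 2)%g = z].

(** The relations show that every element outside <[a]> is of the form a^i b,
    so the order of the group is at most 2 #[a] <= 4n; as it is also at least 4n,
    equality holds throughout.  Conjugation by b inverts a, so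
    (a^i b)^2 = b^2 = a^n. *)
Lemma dicyclic_structure (gT : finGroupType) (n : nat) :
    (0 < n)%N -> is_dicyclic_group gT n ->
  exists (H : {group gT}) (z : gT), cyclic H /\ half_with_common_square H z n.
Proof.
move=> n0 isoQ.
have le4n : (4 * n <= #|gT|)%N.
  have [rT [G [leG homG]]] := dicyclic_model n0.
  by move: homG; rewrite -isoQ -cardsT => /leq_homg; apply: leq_trans.
have /existsP[[a b] /= /eqP[defQ a2n anb2 abba]] := isoGrp_hom isoQ.
have aJb : (a ^ b = a^-1)%g by rewrite conjgE abba mulKg.
have coverQ y : y \notin <[a]>%g -> exists i, y = (a ^+ i * b)%g.
  have : y \in [set: gT]%g by rewrite inE.
  rewrite -defQ norm_joinEr; last first.
    by rewrite cycle_subG; apply/normP; rewrite -cycleJ aJb cycleV.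
  case/imset2P=> _ _ /cycleP[i ->] /cycleP[j ->] -> {y}.
  rewrite -(odd_double_half j) addnC -mul2n expgD expgM -anb2 -expgM mulgA -expgD.
  case: (odd j); first by exists (i + n * j./2)%N.
  by rewrite mulg1 mem_cycle.
have le2a : (#|gT| <= 2 * #[a]%g)%N.
  rewrite mul2n -addnn -cardsT -[X in (_ <= _ + X)%N](card_rcoset _ b).
  rewrite -cardsUI; apply: leq_trans (leq_addr _ _).
  apply/subset_leq_card/subsetP => y _; rewrite inE.
  have [//|/coverQ[i ->]] := boolP (y \in _).
  by rewrite mem_rcoset mulgK mem_cycle.
have lea : (#[a]%g <= 2 * n)%N by rewrite dvdn_leq ?muln_gt0 // order_dvdn a2n.
have oa : #[a]%g = (2 * n)%N.
  by apply/eqP; rewrite eqn_leq lea; move: (leq_trans le4n le2a);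
     rewrite -[4%N]/(2 * 2)%N -mulnA leq_pmul2l.
exists <[a]>%G, (a ^+ n)%g; split; first exact: cycle_cyclic.
split=> //.
- by apply/eqP; rewrite eqn_leq le4n (leq_trans le2a) // oa mulnA.
- exact: mem_cycle.
- apply: nt_prime_order => //; first by rewrite -expgM mulnC.
  by rewrite -order_dvdn oa gtnNdvd // ltn_Pmull.
move=> y /coverQ[i ->]; rewrite anb2 !expgS !expg0 !mulg1.
by rewrite {1}(conjgC (a ^+ i)) conjXg aJb expgVn -mulgA mulKg.
Qed.

(** * The power graph of the dicyclic group *)

Lemma power_graph_injm (gT rT : finGroupType) (f : {morphism [set: rT] >-> gT}) :
  ('injm f)%g -> forall x y, power_graph (f x) (f y) = power_graph x y.
Proof.
move=> /injmP injf x y.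
have f_inj : injective f by move=> u v; apply: injf; rewrite inE.
have memf u v : (f u \in <[f v]>%g) = (u \in <[v]>%g).
  by rewrite -morphim_cycle ?inE // morphimE setTI mem_imset.
by rewrite /power_graph (inj_eq f_inj) !memf.
Qed.

(** Whether x is a power of y does not depend on the ambient group: the power
    graph of a subgroup is the induced subgraph on it. *)
Lemma isog_degree_sum (gT rT : finGroupType) (H : {group gT}) :
    [set: rT]%g \isog H ->
  (\sum_x vertex_degree (@power_graph rT) x)%N
    = edges_between (@power_graph gT) H H.
Proof.
case/isogP=> f injf <-.
have f_inj : injective f by move=> u v; apply: (injmP injf); rewrite inE.
rewrite morphimEdom /edges_between big_imset /=; last by move=> u v _ _ /f_inj.
apply: eq_big => x; first by rewrite inE.
move=> _; rewrite /vertex_degree.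
rewrite -(card_imset _ f_inj); apply: eq_card => y; rewrite inE.
apply/imsetP/andP => [[u + ->]|[/imsetP[u _ ->]]].
  by rewrite inE => xu; rewrite power_graph_injm // imset_f.
by rewrite power_graph_injm // => xu; exists u; rewrite ?inE.
Qed.

(** Since z is an involution, an element u outside H has order 4, with powers
    1, u, z = u^2 and u^-1.  If conversely x is a power of y, then y is outside H
    too, as H is a subgroup; so x is one of the four powers of y, and only
    x = y^-1 is possible. *)
Lemma power_graph_outer_half (gT : finGroupType) (H : {group gT}) (z : gT) n :
    half_with_common_square H z n ->
  forall x y, x \notin H -> power_graph x y = (y \in [set 1%g; z; (x^-1)%g]).
Proof.
case=> _ _ zH oz sq x y xH.
have z1 : z != 1%g by rewrite -order_gt1 oz.
have mem_cyc u v : u \notin H -> v \in <[u]>%g ->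
    [\/ v = 1%g, v = u, v = z | v = (u^-1)%g].
  move=> uH /cycleP[k ->].
  have u4 : (u ^+ 4 = 1)%g.
    by rewrite -[4%N]/(2 * 2)%N expgM (sq u uH) -oz expg_order.
  rewrite -(expg_mod k u4); have := ltn_pmod k (isT : 0 < 4)%N.
  case: (k %% 4)%N => [|[|[|[|//]]]] _; first by constructor 1.
  - by constructor 2.
  - by constructor 3; rewrite sq.
  - by constructor 4; apply/eqP; rewrite eq_sym eq_invg_mul -expgS u4.
rewrite /power_graph !inE; apply/andP/idP => [[xy /orP[]]|].
- by case/(mem_cyc _ _ xH) => e; rewrite e ?eqxx ?orbT // in xy *.
- have [yH|yH] := boolP (y \in H).
    by move=> xy'; case/negP: xH; apply: subsetP xy'; rewrite cycle_subG.
  case/(mem_cyc _ _ yH) => e.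
  + by rewrite e group1 in xH.
  + by rewrite e eqxx in xy.
  + by rewrite e zH in xH.
  + by rewrite e invgK eqxx orbT.
case/orP=> [/orP[]|] /eqP -> //.
- by rewrite group1; split=> //; apply: contraNneq xH => ->.
- by rewrite -{2}(sq x xH) mem_cycle; split=> //; apply: contraNneq xH => ->.
- rewrite groupV cycle_id; split=> //; apply: contraNneq z1 => e.
  by rewrite -(sq x xH) expgS expg1 {1}e mulVg.
Qed.

(** Each element outside H has the two neighbours 1 and z in H and the neighbour
    y^-1 outside, so the block form with p = mu - 1 and q = 2 is at least
    2n (D p^2 + 4 p q + q^2) = mu 2n (p^2 + q^2). *)
Lemma power_graph_radius_ge (R : realType) (gT : finGroupType) (H : {group gT})
    (z : gT) (n : nat) (D : R) :
    (0 < n)%N -> half_with_common_square H z n ->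
    (edges_between (@power_graph gT) H H)%:R = (2 * n)%:R * D ->
  2^-1 * ((D + 1) + Num.sqrt ((D - 1) ^+ 2 + 16))
    <= spectral_radius R (@power_graph gT).
Proof.
move=> n0 hH hD; have [oH oG zH oz sq] := hH.
have z1 : z != 1%g by rewrite -order_gt1 oz.
have oC : #|~: H| = (2 * n)%N.
  by have := cardsC H; rewrite oH oG; lia.
set mu := _ * _.
(* The characteristic equation of [[D, 2], [2, 1]]. *)
have mu_eq : (mu - D) * (mu - 1) = 4.
  have := @sqr_sqrtr R ((D - 1) ^+ 2 + 16); rewrite addr_ge0 ?sqr_ge0 // => /(_ isT).
  by rewrite /mu; set s := Num.sqrt _ => s2; field: s2.
(* Makes the test vector nonnegative, so that lower bounds on the numbers of
   edges suffice. *)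
have mu1 : 1 <= mu.
  have : `|D - 1| <= Num.sqrt ((D - 1) ^+ 2 + 16).
    by rewrite -sqrtr_sqr ler_wsqrtr // lerDl.
  by rewrite /mu => /ler_normlP[]; lra.
have outH : (4 * n <= edges_between (@power_graph gT) (~: H) H)%N.
  have -> : (4 * n = \sum_(x in ~: H) 2)%N by rewrite sum_nat_const oC; lia.
  apply: leq_sum => x; rewrite inE => xH.
  have <- : #|[set 1%g; z]| = 2%N by rewrite cards2 eq_sym z1.
  apply/subset_leq_card/subsetP => y y1z; rewrite inE (power_graph_outer_half hH) //.
  rewrite inE y1z /= andbT.
  by case/set2P: y1z => ->.
have outC : (2 * n <= edges_between (@power_graph gT) (~: H) (~: H))%N.
  have -> : (2 * n = \sum_(x in ~: H) 1)%N by rewrite sum1_card.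
  apply: leq_sum => x; rewrite inE => xH; apply/card_gt0P; exists (x^-1)%g.
  by rewrite !inE groupV xH (power_graph_outer_half hH) // !inE eqxx orbT.
have G0 : (0 < #|gT|)%N by rewrite oG muln_gt0.
have := spectral_radius_ge_blocks (R := R) (H : {set gT}) (mu - 1) 2 G0
  (@power_graph_sym gT).
rewrite hD oH oC -mulrDl => le.
have N0 : (0 : R) < (2 * n)%:R by rewrite ltr0n muln_gt0.
have S0 : 0 < (mu - 1) ^+ 2 + 2 ^+ 2 by have := sqr_ge0 (mu - 1); lra.
rewrite -(ler_pM2r (mulr_gt0 S0 N0)); apply: le_trans le.
move: outH outC; rewrite -!(ler_nat R) => outH outC.
have -> : mu * (((mu - 1) ^+ 2 + 2 ^+ 2) * (2 * n)%:R) =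
  (mu - 1) ^+ 2 * ((2 * n)%:R * D) + 2 * (mu - 1) * 2 * (4 * n)%:R
  + 2 ^+ 2 * (2 * n)%:R.
  rewrite (_ : (4 * n)%:R = 2 * (2 * n)%:R); last by rewrite -natrM mulnA.
  have e : D * (mu - 1) = mu * (mu - 1) - 4 by rewrite -mu_eq; ring.
  transitivity ((2 * n)%:R * ((mu - 1) * (D * (mu - 1)) + 8 * (mu - 1) + 4)).
    by rewrite e; ring.
  by ring.
apply: lerD; last by apply: ler_wpM2l; first exact: sqr_ge0.
by apply: lerD => //; apply: ler_wpM2l => //; rewrite !mulr_ge0 // subr_ge0.
Qed.

(** The three inequalities A w <= (2n + 1) w are, with total weight 2n^2 + 2n on
    H and 4n off H:
    - at x = 1, z: (2n^2 + 2n) + 4n - 2n <= (2n + 1) 2n, which amounts to n >= 1;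
    - elsewhere in H, with neighbours in H only: 2n^2 + 2n - n = (2n + 1) n;
    - off H, with neighbours 1, z, x^-1: 2n + 2n + 2 = (2n + 1) 2. *)
Lemma power_graph_radius_le (R : realType) (gT : finGroupType) (H : {group gT})
    (z : gT) (n : nat) :
    (0 < n)%N -> half_with_common_square H z n ->
  spectral_radius R (@power_graph gT) <= (2 * n + 1)%:R.
Proof.
move=> n0 hH; have [oH oG zH oz sq] := hH.
have z1 : z != 1%g by rewrite -order_gt1 oz.
pose Z : {set gT} := [set 1%g; z].
have ZH : Z \subset H by apply/subsetP => x /set2P[]->.
have oZ : #|Z| = 2%N by rewrite cards2 eq_sym z1.
pose w x : R := if x \in Z then (2 * n)%:R else if x \in H then n%:R else 2.
have n1R : 1 <= n%:R :> R by rewrite ler1n.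
have w_gt0 x : 0 < w x by rewrite /w natrM; do 2?case: ifP; lra.
have wZ x : x \in Z -> w x = (2 * n)%:R by rewrite /w => ->.
have wH x : x \in H :\: Z -> w x = n%:R.
  by rewrite inE /w => /andP[/negPf -> ->].
have wC x : x \notin H -> w x = 2.
  move=> xH; rewrite /w (negPf xH); case: ifP => // /(subsetP ZH) xH'.
  by rewrite xH' in xH.
have sumH : \sum_(x in H) w x = 2 * n%:R ^+ 2 + 2 * n%:R.
  rewrite (big_setID Z) /= (setIidPr ZH) (eq_bigr _ wZ) (eq_bigr _ wH) !sumr_const.
  have := cardsID Z H; rewrite (setIidPr ZH) oZ oH => e.
  have oHZ : #|H :\: Z|%:R = 2 * n%:R - 2 :> R.
    by rewrite -natrM -e natrD addrC addKr.
  by rewrite -[X in X + _]mulr_natr -[X in _ + X]mulr_natr oHZ natrM; ring.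
have sumC : \sum_(x | x \notin H) w x = 4 * n%:R.
  rewrite (eq_bigr _ wC) sumr_const.
  have := cardC (mem H); rewrite oH oG => /eqP.
  rewrite -(eqr_nat R) natrD !natrM => /eqP; rewrite -mulr_natr; lra.
have G0 : (0 < #|gT|)%N by rewrite oG muln_gt0.
apply: (spectral_radius_le (w := w)) => // [|x]; first exact: power_graph_sym.
have w0 y : 0 <= w y by exact: ltW.
have nbr_le (P : pred gT) : (forall y, power_graph x y -> P y) ->
    \sum_(y | power_graph x y) w y <= \sum_(y | P y) w y.
  move=> sub; rewrite big_mkcond [leRHS]big_mkcond; apply: ler_sum => y _.
  by case: ifP => [/sub ->|_] //; case: ifP.
have [xH|xH] := boolP (x \in H); last first.
  apply: (@le_trans _ _ (\sum_(y in [set 1%g; z; (x^-1)%g]) w y)).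
    by apply: nbr_le => y; rewrite (power_graph_outer_half hH).
  rewrite setUC big_setU1 /=; last first.
    by apply: contra xH => /(subsetP ZH); rewrite groupV.
  by rewrite (eq_bigr _ wZ) sumr_const oZ !wC ?groupV // natrD natrM -mulr_natr; lra.
have [xZ|xZ] := boolP (x \in Z).
  apply: (@le_trans _ _ (\sum_(y | y != x) w y)).
    by apply: nbr_le => y /andP[]; rewrite eq_sym.
  rewrite -(lerD2l (w x)) -(bigD1 x (P := xpredT) (F := w)) //=.
  rewrite (bigID (mem H)) /= sumH sumC wZ // natrD natrM.
  by nra.
apply: (@le_trans _ _ (\sum_(y in H | y != x) w y)).
  apply: nbr_le => y xy; apply/andP; split; last by case/andP: xy; rewrite eq_sym.
  apply: contraNT xZ => yH; move: xy.
  rewrite power_graph_sym (power_graph_outer_half hH) // !inE -orbA.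
  case/or3P => [->|->|/eqP e] //; rewrite ?orbT //.
  by rewrite e groupV (negPf yH) in xH.
rewrite -(lerD2l (w x)) -(bigD1 x (P := mem H) (F := w)) //= sumH.
rewrite wH; last by rewrite inE xZ.
by rewrite natrD natrM; lra.
Qed.

Theorem theorem2p7 (R : realType) (n : nat) (Q C : finGroupType)
    (hn : (2 <= n)%N)
    (hQ : is_dicyclic_group Q n)
    (hC : is_cyclic_group C (2 * n)) :
  let D_avg : R := average_degree R (@power_graph C) in
  let lambda1 : R := spectral_radius R (@power_graph Q) in
  2^-1 * ((D_avg + 1) + Num.sqrt ((D_avg - 1) ^+ 2 + 16)) <= lambda1
  /\ lambda1 <= (2 * n + 1)%:R.
Proof.
have n0 : (0 < n)%N by apply: leq_trans hn.
have [H [z [cycH hH]]] := dicyclic_structure n0 hQ; have [oH _ _ _ _] := hH.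
have [cycC oC] := hC.
split; last exact: power_graph_radius_le hH.
apply: (power_graph_radius_ge _ hH) => //.
have isoCH : [set: C]%g \isog H.
  by rewrite isog_cyclic_card // cycH cardsT oC oH eqxx.
rewrite -(isog_degree_sum isoCH) /average_degree oC mulrC divfK //.
by rewrite pnatr_eq0 -lt0n muln_gt0.
Qed.
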